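(* Let $T$ be a tree with nonnegative edge lengths, and let a set of service requests be given, each located at a node of $T$ with a time window of unit length $[a,a+1]$, where no $a$ is an integer (perturbing by a negligible amount if necessary). Assume a single vehicle traveling at a fixed speed can service all requests within their time windows. Algorithm SINGLE-REPAIR: divide time into periods $[j, j+1)$, $j=0,1,2,\dots$; each window meets exactly two consecutive periods $[j,j+1)$ and $[j+1,j+2)$, and is expanded to $[j, j+2)$; put the request in set $\mathcal{E}$ if $j$ is even and in $\mathcal{O}$ if $j$ is odd. Compute a service run $R_{\mathcal{E}}$ that services the maximum possible number of requests of $\mathcal{E}$ with respect to the expanded windows, and similarly $R_{\mathcal{O}}$ for $\mathcal{O}$. Output $R_{\mathcal{E}}$, $R_{\mathcal{O}}$, and, for each of these two runs, a copy shifted 1 time unit earlier and a copy shifted 1 time unit later. Then the at most 6 output runs together service every request within its original (unexpanded) time window; that is, SINGLE-REPAIR is a 6-approximation to the Minimum Vehicle $OPT=1$ Problem on trees.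
   Context: A service run is a route of a single vehicle moving at a fixed speed along the tree (which may start at any node at any time and stop anywhere); it services a request if it is at the request's node at some time within the request's time window. The Minimum Vehicle $OPT=1$ Problem: given such requests on a graph under the promise that one vehicle can service all of them within their windows, find as few service runs as possible that together service all requests within their windows. *)

(* Defs.v *)
From HB Require Import structures.
From mathcomp Require Import all_boot all_order all_algebra.
From mathcomp Require Import boolp reals.
Set Implicit Arguments.
Unset Strict Implicit.
Unset Printing Implicit Defensive.
Import Order.TTheory GRing.Theory Num.Theory.
Local Open Scope ring_scope.

Record tree (R : realType) := Tree {
  node :> finType;
  edge : rel node;
  len : node -> node -> R;
  tree_nonempty : (0 < #|node|)%N;
  edge_sym : symmetric edge;
  edge_irr : irreflexive edge;
  tree_connected : forall u v, connect edge u v;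
  (* [ucycle] also holds of single edges traversed back and forth (size 2) and
     of the empty sequence, hence the bound *)
  tree_acyclic : forall c : seq node, ucycle edge c -> (size c <= 2)%N;
  len_sym : forall u v, edge u v -> len u v = len v u;
  len_ge0 : forall u v, edge u v -> 0 <= len u v
}.

(* A point of the tree: [inl u] is the node [u]; [inr (u, v, x)] is the point
   strictly inside the edge uv at distance [x] from [u], so that
   [inr (u, v, x)] and [inr (v, u, len u v - x)] denote the same point. *)
Definition point (R : realType) (T : tree R) : Type := (T + T * T * R)%type.

Definition on_edge (R : realType) (T : tree R) (u v : T) (p : point T) (x : R)
    : Prop :=
  edge u v /\
  match p with
  | inl w => (w = u /\ x = 0) \/ (w = v /\ x = len u v)
  | inr (u', v', y) =>
      0 < x < len u v /\
      ((u' = u /\ v' = v /\ y = x) \/ (u' = v /\ v' = u /\ y = len u v - x))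
  end.

(* A service run is recorded by its successive waypoints (time, point).
   Between two waypoints the vehicle either stands still or drives along a
   single edge at speed exactly [s]; inner points of edges may be waypoints, so
   the vehicle may turn around, pause or end its run in the middle of an edge. *)
Definition waypoint (R : realType) (T : tree R) : Type := (R * point T)%type.

Definition leg (R : realType) (T : tree R) (s : R) (w w' : waypoint T) : Prop :=
  (w.2 = w'.2 /\ w.1 <= w'.1) \/
  (exists (u v : T) (x y : R),
     [/\ on_edge u v w.2 x, on_edge u v w'.2 y & w'.1 = w.1 + `|y - x| / s]).

Definition is_run (R : realType) (T : tree R) (s : R) (r : seq (waypoint T))
    : Prop :=
  exists (t0 : R) (v0 : T) (r' : seq (waypoint T)),
    r = (t0, inl v0) :: r' /\
    path (fun w w' => `[< leg s w w' >]) (t0, inl v0) r'.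

(* A drive along an edge meets nodes only at its two waypoints, so the vehicle
   is at a node either at a waypoint or during a pause at that node. *)
Definition is_at (R : realType) (T : tree R) (r : seq (waypoint T)) (t : R)
    (v : T) : Prop :=
  ((t, inl v) : waypoint T) \in r \/
  (exists t1 t2 : R,
     infix [:: ((t1, inl v) : waypoint T); (t2, inl v)] r /\ t1 <= t <= t2).

Definition shift_run (R : realType) (T : tree R) (d : R)
    (r : seq (waypoint T)) : seq (waypoint T) :=
  [seq (w.1 + d, w.2) | w <- r].

(* (v, a): a request at node [v] with time window [a, a + 1] *)
Definition request (R : realType) (T : tree R) : Type := (T * R)%type.

Definition window (R : realType) (T : tree R) (q : request T) : interval R :=
  `[q.2, q.2 + 1].

Definition period (R : realType) (j : nat) : interval R :=
  `[j%:R, (j + 1)%:R[.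

(* the j such that the window of q meets the periods j and j + 1 *)
Definition first_period (R : realType) (T : tree R) (q : request T) : nat :=
  Num.truncn q.2.

Definition expanded_window (R : realType) (T : tree R) (q : request T)
    : interval R :=
  `[(first_period q)%:R, (first_period q + 2)%:R[.

Definition services (R : realType) (T : tree R) (W : request T -> interval R)
    (r : seq (waypoint T)) (q : request T) : Prop :=
  exists t : R, t \in W q /\ is_at r t q.1.

Definition num_serviced (R : realType) (T : tree R)
    (W : request T -> interval R) (A : seq (request T))
    (r : seq (waypoint T)) : nat :=
  count (fun q => `[< services W r q >]) A.

Definition is_max_run (R : realType) (T : tree R) (s : R)
    (W : request T -> interval R) (A : seq (request T))
    (r : seq (waypoint T)) : Prop :=
  is_run s r /\
  forall r', is_run s r' -> (num_serviced W A r' <= num_serviced W A r)%N.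

Definition even_requests (R : realType) (T : tree R) (Q : seq (request T)) :=
  [seq q <- Q | ~~ odd (first_period q)].

Definition odd_requests (R : realType) (T : tree R) (Q : seq (request T)) :=
  [seq q <- Q | odd (first_period q)].

(* A relation, because SINGLE-REPAIR may pick any of the maximum runs. *)
Definition single_repair (R : realType) (T : tree R) (s : R)
    (Q : seq (request T)) (out : seq (seq (waypoint T))) : Prop :=
  exists rE rO : seq (waypoint T),
    [/\ is_max_run s (@expanded_window R T) (even_requests Q) rE,
        is_max_run s (@expanded_window R T) (odd_requests Q) rO &
        out = [:: rE; shift_run (-1) rE; shift_run 1 rE;
                  rO; shift_run (-1) rO; shift_run 1 rO]].

Definition is_solution (R : realType) (T : tree R) (s : R)
    (Q : seq (request T)) (S : seq (seq (waypoint T))) : Prop :=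
  (forall r, r \in S -> is_run s r) /\
  (forall q, q \in Q -> exists r, r \in S /\ services (@window R T) r q).

Definition is_approx_solution (R : realType) (T : tree R) (s : R) (c : nat)
    (Q : seq (request T)) (S : seq (seq (waypoint T))) : Prop :=
  is_solution s Q S /\
  forall S', is_solution s Q S' -> (size S <= c * size S')%N.

(* Main.v *)
Require Import Defs.
From mathcomp Require Import all_boot all_order all_algebra.
From mathcomp Require Import boolp reals.
From mathcomp Require Import lra zify.
Import Order.TTheory GRing.Theory Num.Theory.
Local Open Scope ring_scope.

(** The run promised by the hypothesis services every request inside its
    window, a fortiori inside its expanded window; hence a maximum run for the
    expanded windows of [E] (or [O]) misses no request of that set. If it is at
    the node of a request with window [[a, a + 1]] at a time [t] of the expanded
    window [[j, j + 2)], where [j < a < j + 1], then one of [t], [t + 1] and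
    [t - 1] lies in [[a, a + 1]], according to whether [t] is inside, before or
    after the window. *)

Section SingleRepair.
Variables (R : realType) (T : tree R) (s : R).
Implicit Types (r : seq (waypoint T)) (q : request T) (Q A : seq (request T)).

(** A leg constrains times only through their order and difference, so a common delay preserves
    it. *)
Lemma shift_run_is_run (d : R) r : is_run s r -> is_run s (shift_run d r).
Proof.
move=> [t0 [v0 [r' [-> r'P]]]].
exists (t0 + d), v0, (shift_run d r'); split => //.
(* Once the head is written as the shift of the old first waypoint, that waypoint can be generalized
   for the induction. *)
rewrite -[(t0 + d, _)]/((t0, inl v0 : point T).1 + d, (t0, inl v0 : point T).2).
elim: r' (t0, inl v0 : point T) r'P => [//|w' r' IH] w /= /andP[/asboolP ww' r'P].
apply/andP; split; last exact: IH.
apply/asboolP; case: ww' => [[e le_ww']|[u [v [x [y [wx w'y tE]]]]]].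
  by left; split => //=; rewrite lerD2r.
by right; exists u, v, x, y; split => //=; rewrite tE addrAC.
Qed.

Lemma shift_run_is_at (d : R) r (t : R) (v : T) :
  is_at r t v -> is_at (shift_run d r) (t + d) v.
Proof.
case=> [tr|[t1 [t2 [t12 tP]]]]; first by left; apply/mapP; exists (t, inl v).
right; exists (t1 + d), (t2 + d); split; last by rewrite !lerD2r.
have /infixP[p [p' ->]] := t12.
by apply/infixP; exists (shift_run d p), (shift_run d p'); rewrite /shift_run !map_cat.
Qed.

Lemma first_period_bounds q : 0 <= q.2 -> q.2 \isn't a Num.int ->
  (first_period q)%:R < q.2 < (first_period q).+1%:R.
Proof.
move=> q_ge0 qNint; have /andP[jq ->] := truncn_itv q_ge0.
rewrite andbT lt_neqAle jq andbT; apply: contraNneq qNint => <-.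
by rewrite intr_nat.
Qed.

Lemma window_meets_period q (k : nat) : 0 <= q.2 -> q.2 \isn't a Num.int ->
  (exists t : R, t \in window q /\ t \in period R k) <->
  (k = first_period q \/ k = (first_period q).+1).
Proof.
move=> q_ge0 qNint; have /andP[] := first_period_bounds _ q_ge0 qNint.
set j := first_period q => jq qj; rewrite /window /period; split.
  move=> [t []]; rewrite !in_itv /= addn1 => /andP[qt tq] /andP[kt tk].
  (* With [a = q.2], the common time gives [j < a <= t < k + 1] and [k <= t <= a + 1 < j + 2], which
     leaves only [k = j] and [k = j + 1]. *)
  have jk : (j < k.+1)%N.
    by rewrite -(ltr_nat R); apply: lt_trans jq (le_lt_trans qt tk).
  have kj : (k < j.+2)%N.
    by rewrite -(ltr_nat R) -[in ltRHS]natr1; lra.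
  by lia.
(* The left end of the window lies in period [j]; the integer [j + 1] lies in the window and opens
   the next period. *)
case=> ->; [exists q.2 | exists j.+1%:R]; rewrite !in_itv /= !addn1.
  by rewrite qj; split; lra.
by rewrite lexx ltr_nat ltnSn (ltW qj) /=; split=> //; rewrite -natr1; lra.
Qed.

Lemma window_sub_expanded q (t : R) : 0 <= q.2 -> q.2 \isn't a Num.int ->
  t \in window q -> t \in expanded_window q.
Proof.
move=> q_ge0 qNint; have := first_period_bounds _ q_ge0 qNint.
rewrite /window /expanded_window !in_itv /= addn2 -!natr1; lra.
Qed.

Lemma services_expanded r q : 0 <= q.2 -> q.2 \isn't a Num.int ->
  services (@window R T) r q -> services (@expanded_window R T) r q.
Proof.
by move=> q_ge0 qNint [t [tq rt]]; exists t; split=> //; exact: window_sub_expanded.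
Qed.

Lemma repair r q : 0 <= q.2 -> q.2 \isn't a Num.int ->
  services (@expanded_window R T) r q ->
  exists2 r', r' \in [:: r; shift_run (-1) r; shift_run 1 r] &
    services (@window R T) r' q.
Proof.
move=> q_ge0 qNint [t []]; have := first_period_bounds _ q_ge0 qNint.
rewrite /expanded_window in_itv /= addn2 -!natr1 => jq tj rt.
have [tq|qt] := ltP t q.2.
  (* Too early: [t < q.2 < j + 1 <= t + 1]. *)
  exists (shift_run 1 r); first by rewrite !inE eqxx !orbT.
  by exists (t + 1); split; [rewrite in_itv /=; lra | exact: shift_run_is_at].
have [tq|qt'] := leP t (q.2 + 1).
  by exists r; [rewrite inE eqxx | exists t; rewrite in_itv /= qt tq].
(* Too late: [q.2 < t - 1 < j + 1 < q.2 + 1]. *)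
exists (shift_run (-1) r); first by rewrite !inE eqxx !orbT.
by exists (t - 1); split; [rewrite in_itv /=; lra | exact: shift_run_is_at].
Qed.

(** No run can have a count above [size A], and [r] attains it. *)
Lemma services_all_max_run W A r : is_run s r ->
  {in A, forall q, services W r q} -> is_max_run s W A r.
Proof.
move=> r_run rA; split=> // r' _; rewrite [leqRHS](_ : _ = size A) ?count_size //.
by apply/eqP; rewrite -all_count; apply/allP => q /rA /asboolP.
Qed.

Lemma max_run_services_all W A r r0 : is_run s r0 ->
  {in A, forall q, services W r0 q} -> is_max_run s W A r ->
  {in A, forall q, services W r q}.
Proof.
move=> r0_run r0A [_ /(_ r0 r0_run)].
rewrite [leqLHS](_ : _ = size A); last first.
  by apply/eqP; rewrite -all_count; apply/allP => q /r0A /asboolP.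
move=> le_Ar q qA; apply/asboolP; move: q qA; apply/allP.
by rewrite all_count eqn_leq count_size.
Qed.

End SingleRepair.

Theorem mainTheorem2 (R : realType) (T : tree R) (s : R)
    (Q : seq (request T)) :
  0 < s ->
  (forall q, q \in Q -> 0 <= q.2 /\ q.2 \isn't a Num.int) ->
  (exists r, is_run s r /\
     forall q, q \in Q -> services (@window R T) r q) ->
  (forall q, q \in Q -> forall k : nat,
     (exists t : R, t \in window q /\ t \in period R k) <->
     (k = first_period q \/ k = (first_period q).+1)) /\
  (exists out, single_repair s Q out) /\
  (forall out, single_repair s Q out ->
     [/\ (size out <= 6)%N,
         is_solution s Q out &
         (Q != [::] -> is_approx_solution s 6 Q out)]).
Proof.
move=> _ QP [r0 [r0_run r0Q]].
have r0E P : {in [seq q <- Q | P q], forall q, services (@expanded_window R T) r0 q}.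
  move=> q; rewrite mem_filter => /andP[_ qQ]; have [? ?] := QP q qQ.
  exact: services_expanded (r0Q q qQ).
split; first by move=> q /QP[? ?] k; exact: window_meets_period.
split.
  (* The promised run is maximum for both parity classes, so it can play both [rE] and [rO]. *)
  by eexists; exists r0, r0; split=> //; apply: services_all_max_run (r0E _).
move=> _ [rE [rO [rE_max rO_max ->]]].
set out := [:: _; _; _; _; _; _].
have sol : is_solution s Q out.
  split=> [r|q qQ].
    have [[rE_run _] [rO_run _]] := (rE_max, rO_max).
    by rewrite !inE; do 5?[case/predU1P=> [->|]]; last move/eqP->;
       rewrite //; exact: shift_run_is_run.
  have [q_ge0 qNint] := QP q qQ.
  have [q_odd|q_even] := boolP (odd (first_period q)).
    have : services (@expanded_window R T) rO q.
      apply: (max_run_services_all _ _ _ _ _ _ _ r0_run (r0E _) rO_max).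
      by rewrite mem_filter q_odd.
    case/(repair _ _ _ _ q_ge0 qNint) => r r_out rq; exists r; split=> //.
    (* The last three runs of [out] are the copies of [rO], the first three those of [rE]. *)
    by rewrite -[out]/([:: _; _; _] ++ [:: _; _; _]) mem_cat r_out orbT.
  have : services (@expanded_window R T) rE q.
    apply: (max_run_services_all _ _ _ _ _ _ _ r0_run (r0E _) rE_max).
    by rewrite mem_filter q_even.
  case/(repair _ _ _ _ q_ge0 qNint) => r r_out rq; exists r; split=> //.
  by rewrite -[out]/([:: _; _; _] ++ [:: _; _; _]) mem_cat r_out.
split=> // Q_neq0; split=> // -[|r S'] [_ S'Q]; last by rewrite mulnS leq_addr.
case: Q Q_neq0 S'Q {QP r0Q r0E rE_max rO_max sol} => // q Q _ /(_ q (mem_head _ _)).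
by case=> r [].
Qed.
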